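(* For each integer $k\geq2$ let $\mathcal{A}_k$ be the surface measure on the unit sphere $\mathbf{S}^{k-1}\subset\mathbb{R}^k\subset\mathbb{C}^k$, let $s_k=\mathcal{A}_k(\mathbf{S}^{k-1})=\dfrac{2\pi^{k/2}}{\Gamma(k/2)}$ be its total mass, and let $\sigma_k=\frac{1}{s_k}\,\mathcal{A}_k$ be the normalized surface measure. Then for every integer $k\geq2$, every real $\nu\geq1$, and every $u\in\mathbb{C}^k$ with $|u|=1$, $$\int_{\mathbf{S}^{k-1}}\big|\log|\langle a,u\rangle|\big|^\nu\,d\sigma_k(a)\leq M_\nu\,(\log k)^\nu,$$ where $M_\nu>0$ is a (finite) constant depending only on $\nu$ (in particular, not on $k$ or $u$).
   Context: For $a,v\in\mathbb{C}^k$ with $a=(a_1,\ldots,a_k)$, $v=(v_1,\ldots,v_k)$, the (bilinear) pairing is $\langle a,v\rangle=\sum_{j=1}^k a_jv_j$ (no complex conjugation), and $|v|^2=\langle v,\overline v\rangle=\sum_{j=1}^k|v_j|^2$. $\mathbf{S}^{k-1}=\{a\in\mathbb{R}^k:|a|=1\}$. $\Gamma$ is the Euler Gamma function. The logarithm is the natural logarithm. *)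

(* Defs.v *)
From HB Require Import structures.
From mathcomp Require Import all_boot all_order all_algebra.
From mathcomp Require Import complex.
From mathcomp Require Import all_classical all_reals all_analysis measurable_realfun.

Set Implicit Arguments.
Unset Strict Implicit.
Unset Printing Implicit Defensive.

Import Order.TTheory GRing.Theory Num.Theory.
Import numFieldNormedType.Exports.

Local Open Scope classical_set_scope.
Local Open Scope ring_scope.

(* R^k and C^k are k.-tuple R and k.-tuple R[i]; the former carries the
   product (Borel) sigma-algebra provided by the library. *)

Definition pairing (R : realType) (k : nat) (a v : k.-tuple R[i]) : R[i] :=
  \sum_(j < k) tnth a j * tnth v j.

Definition conj_tuple (R : realType) (k : nat) (v : k.-tuple R[i]) :
  k.-tuple R[i] := [tuple of map (@conjc R) v].

(* |v| = sqrt <v, conj v>; the pairing <v, conj v> is a nonnegative real, so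
   only its real part is kept. *)
Definition cnorm (R : realType) (k : nat) (v : k.-tuple R[i]) : R :=
  Num.sqrt (complex.Re (pairing v (conj_tuple v))).

Definition real_tuple (R : realType) (k : nat) (a : k.-tuple R) :
  k.-tuple R[i] := [tuple of map (fun x : R => (x%:C)%C) a].

Definition enorm (R : realType) (k : nat) (a : k.-tuple R) : R :=
  Num.sqrt (\sum_(j < k) tnth a j ^+ 2).

Definition unit_sphere (R : realType) (k : nat) : set (k.-tuple R) :=
  [set a | enorm a = 1].
Arguments unit_sphere : clear implicits.

Section lebesgue_cons.
Context {R : realType} {k : nat}.
Local Open Scope ereal_scope.

Definition cons_pair (x : measurableTypeR R * k.-tuple R) : k.+1.-tuple R :=
  [tuple of (x.1 : R) :: x.2].

Lemma measurable_cons_pair : measurable_fun setT cons_pair.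
Proof.
apply: (@measurable_cons _ _ _ _ (fst : measurableTypeR R * k.-tuple R -> R)).
- exact: measurable_fst.
- exact: measurable_snd.
Qed.

Variable mu : {sigma_finite_measure set (k.-tuple R) -> \bar R}.

Definition lebesgue_cons : set (k.+1.-tuple R) -> \bar R :=
  pushforward (@lebesgue_measure R \x mu) cons_pair.

Let pushforward_cons : {measure set (k.+1.-tuple R) -> \bar R} :=
  measure_function_pushforward__canonical__measure_function_Measure
    (@lebesgue_measure R \x mu) measurable_cons_pair.

HB.instance Definition _ := isMeasure.Build _ _ _ lebesgue_cons
  (measure0 pushforward_cons) (measure_ge0 pushforward_cons)
  (@measure_semi_sigma_additive _ _ _ pushforward_cons).

Let sigma_finite_lebesgue_cons : sigma_finite setT lebesgue_cons.
Proof.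
have [F TF oF] : sigma_finite setT (@lebesgue_measure R \x mu).
  have /sigma_finiteP[F [TF ndF Foo]] := sigma_finiteT (@lebesgue_measure R).
  have /sigma_finiteP[G [TG ndG Goo]] := sigma_finiteT mu.
  exists (fun n => F n `*` G n).
    rewrite -setXTT TF TG predeqE => -[x y]; split.
      move=> [/= [n _ Fnx] [m _ Gmy]]; exists (maxn n m) => //; split.
      - by move: x Fnx; exact/subsetPset/ndF/leq_maxl.
      - by move: y Gmy; exact/subsetPset/ndG/leq_maxr.
    by move=> [n _ []/= ? ?]; split; exists n.
  move=> n; have [? ?] := Foo n; have [? ?] := Goo n.
  split; first exact: measurableX.
  by rewrite product_measure1E// lte_mul_pinfty// ge0_fin_numE.
pose uncons (t : k.+1.-tuple R) : measurableTypeR R * k.-tuple R :=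
  (tnth t ord0 : measurableTypeR R, [tuple of behead t]).
have muncons : measurable_fun setT uncons.
  apply: measurable_fun_pair.
  - exact: (@measurable_tnth _ R k.+1 ord0).
  - exact: measurable_behead.
have unconsK (x : measurableTypeR R * k.-tuple R) : uncons (cons_pair x) = x.
  by case: x => x t; congr pair; apply/val_inj.
exists (fun n => uncons @^-1` F n).
  by rewrite -preimage_bigcup -TF preimage_setT.
move=> n; have [mFn Foo] := oF n; split.
  by rewrite -[X in measurable X]setTI; exact: muncons.
suff -> : lebesgue_cons (uncons @^-1` F n) = (@lebesgue_measure R \x mu) (F n).
  by [].
congr ((@lebesgue_measure R \x mu) _).
by apply/seteqP; split => x /=; rewrite unconsK.
Qed.

HB.instance Definition _ := Measure_isSigmaFinite.Build _ _ _ lebesgue_cons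
  sigma_finite_lebesgue_cons.

End lebesgue_cons.

(* Lebesgue measure on R^k, as the k-fold product of Lebesgue measure on R. *)
Fixpoint lebesgue_tuple (R : realType) (k : nat) :
    {sigma_finite_measure set (k.-tuple R) -> \bar R} :=
  match k with
  | 0 => \d_([tuple] : 0.-tuple R)
  | k'.+1 => lebesgue_cons (lebesgue_tuple R k')
  end.

Lemma lebesgue_tuple_box (R : realType) (k : nat) (A : 'I_k -> set R) :
  (forall i, measurable (A i)) ->
  lebesgue_tuple R k [set x | forall i, A i (tnth x i)] =
  (\prod_(i < k) @lebesgue_measure R (A i))%E.
Proof.
elim: k A => [|k IHk] A mA.
  rewrite big_ord0 /= diracE mem_set//=.
  by case.
rewrite big_ord_recl -IHk; last by move=> i; exact: mA.
rewrite -product_measure1E; last 2 first.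
- exact: mA.
- rewrite (_ : mkset _ =
    \big[setI/setT]_(i < k) ((@tnth _ R)^~ i @^-1` A (lift ord0 i))).
    apply: bigsetI_measurable => i _; rewrite -[X in measurable X]setTI.
    exact: measurable_tnth.
  by apply/seteqP; split => x /=; rewrite -bigcap_seq/= => Ax i /=;
    [move=> _; exact: Ax|exact/Ax/mem_index_enum].
congr ((@lebesgue_measure R \x lebesgue_tuple R k)%E _).
apply/seteqP; split => -[x t] /=.
- move=> Ax; split; first exact: (Ax ord0).
  by move=> i; have := Ax (lift ord0 i); rewrite tnthS.
- move=> [Ax At] i; have [j ->|->] := unliftP ord0 i; last exact: Ax.
  by rewrite tnthS; exact: At.
Qed.

Definition normalize (R : realType) (k : nat) (x : k.-tuple R) : k.-tuple R :=
  [tuple of map (fun t : R => t / enorm x) x].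

Definition punctured_ball (R : realType) (k : nat) : set (k.-tuple R) :=
  [set x | 0 < enorm x <= 1].
Arguments punctured_ball : clear implicits.

(* { r a | 0 < r <= 1, a in E } for E included in the unit sphere *)
Definition cone (R : realType) (k : nat) (E : set (k.-tuple R)) :
  set (k.-tuple R) := @normalize R k @^-1` E `&` punctured_ball R k.

Lemma measurable_enorm (R : realType) (k : nat) :
  measurable_fun setT (@enorm R k).
Proof.
apply: (measurableT_comp (f := @Num.sqrt R)).
  exact: (@continuous_measurable_fun R (@Num.sqrt R) (@sqrt_continuous R)).
apply: measurable_sum => i; apply: measurable_funX; exact: measurable_tnth.
Qed.

Lemma measurable_normalize (R : realType) (k : nat) :
  measurable_fun setT (@normalize R k).
Proof.
apply/measurable_fun_tnthP => i.
have -> : (@tnth k R)^~ i \o @normalize R k =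
    (fun x => tnth x i * enorm x `^ (-1)).
  by apply/funext => x /=; rewrite /normalize tnth_map powR_inv1 ?sqrtr_ge0.
apply: measurable_funM; first exact: measurable_tnth.
apply: (measurableT_comp (f := @powR R ^~ (-1))); first exact: measurable_powR.
exact: measurable_enorm.
Qed.

Lemma measurable_punctured_ball (R : realType) (k : nat) :
  measurable (punctured_ball R k).
Proof.
have -> : punctured_ball R k = @enorm R k @^-1` `]0, 1].
  by apply/seteqP; split => x /=; rewrite in_itv.
by rewrite -[X in measurable X]setTI; apply: measurable_enorm.
Qed.

Section surface_measure.
Context (R : realType) (k : nat).
Local Open Scope ereal_scope.

(* Surface measure on the unit sphere of R^k, as a measure on R^k concentrated
   on the sphere: k times the Lebesgue measure of the truncated cone over E
   (polar coordinates: |cone E| = surface E * \int_0^1 r^(k-1) dr). *)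
Definition surface_measure (E : set (k.-tuple R)) : \bar R :=
  k%:R%:E * lebesgue_tuple R k (cone E).

Let cone_measure : {measure set (k.-tuple R) -> \bar R} :=
  measure_function_pushforward__canonical__measure_function_Measure
    (mrestr (lebesgue_tuple R k) (@measurable_punctured_ball R k))
    (@measurable_normalize R k).

Let scaled_cone_measure : {measure set (k.-tuple R) -> \bar R} :=
  mscale (NngNum (ler0n R k)) cone_measure.

HB.instance Definition _ := isMeasure.Build _ _ _ surface_measure
  (measure0 scaled_cone_measure) (measure_ge0 scaled_cone_measure)
  (@measure_semi_sigma_additive _ _ _ scaled_cone_measure).

End surface_measure.

Definition Gamma (R : realType) (x : R) : R :=
  \int[@lebesgue_measure R]_(t in `]0, +oo[) (t `^ (x - 1) * expR (- t)).

Definition sphere_area (R : realType) (k : nat) : R :=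
  2 * pi `^ (k%:R / 2) / Gamma (k%:R / 2).

Lemma sphere_areaV_ge0 (R : realType) (k : nat) : 0 <= (sphere_area R k)^-1.
Proof.
rewrite invr_ge0 divr_ge0// ?mulr_ge0 ?powR_ge0//.
by apply: Rintegral_ge0 => t _; rewrite mulr_ge0 ?powR_ge0 ?expR_ge0.
Qed.

Definition normalized_surface_measure (R : realType) (k : nat) :
    set (k.-tuple R) -> \bar R :=
  mscale (NngNum (sphere_areaV_ge0 R k)) (@surface_measure R k).

HB.instance Definition _ (R : realType) (k : nat) :=
  Measure.on (@normalized_surface_measure R k).
Arguments normalized_surface_measure : clear implicits.

(* | log |<a, u>| |, with log 0 = -oo, so that the value is +oo where the
   pairing vanishes. *)
Definition abs_log_pairing (R : realType) (k : nat) (a : k.-tuple R)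
    (u : k.-tuple R[i]) : \bar R :=
  (`| lne (Normc.normc (pairing (real_tuple a) u))%:E |)%E.

(* Main.v *)
Require Import Defs.
From mathcomp Require Import all_boot all_order all_algebra.
From mathcomp Require Import complex.
From mathcomp Require Import all_classical all_reals all_analysis.
From mathcomp Require Import measurable_realfun.
From mathcomp Require Import lra ring.

Set Implicit Arguments.
Unset Strict Implicit.
Unset Printing Implicit Defensive.

Import Order.TTheory GRing.Theory Num.Theory.
Import numFieldNormedType.Exports.

Local Open Scope classical_set_scope.
Local Open Scope ring_scope.

(* Let V_k be the volume of the unit ball of R^k.  Slicing along one coordinate
   gives V_{k-1} <= (k+1) V_k, and, for a real vector p, the bound
   2t/|p_j| * V_{k-1} for the volume of the part of the ball where
   |<x, p>| <= t.  A unit vector u has a coordinate whose real or imaginary part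
   has absolute value at least 1/(2k), so that, applying this to the real or
   imaginary part of u, sigma_k(|<a, u>| <= t) <= 8 k^2 t.  At the scale
   L = 2 log k this says that |log|<a, u>|| >= (n+1) L has probability at most
   8 k^(-2n) <= 8 * 4^(-n), whence the nu-th moment is O(L^nu).
   The value of s_k = k V_k comes from computing the integral of
   exp(-t) |{|x|^2 <= t}| over t in two ways: it is pi^(k/2) by induction on k
   (Fubini and the Gauss integral), and V_k Gamma(k/2 + 1) by homogeneity. *)

(** * Affine changes of variable on the real line *)

Section lebesgue_affine.
Context {R : realType}.
Local Notation mu := (@lebesgue_measure R).
Local Open Scope ereal_scope.
Variables (a b : R).
Hypothesis a_gt0 : (0 < a)%R.

Let aff (x : R) : measurableTypeR R := (a * x + b)%R.

Let measurable_aff : measurable_fun setT aff.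
Proof. by apply: measurable_funD => //; exact: measurable_funM. Qed.

Let pushforward_aff : {measure set (measurableTypeR R) -> \bar R} :=
  measure_function_pushforward__canonical__measure_function_Measure
    mu measurable_aff.

Let scaled_pushforward : {measure set (measurableTypeR R) -> \bar R} :=
  mscale (NngNum (ltW a_gt0)) pushforward_aff.

(** Lebesgue measure is determined by its values on the intervals []c, d]]; the preimage of such an
    interval under [aff] has length (d - c) / a, which the scaling by a corrects. *)
Let lebesgue_measure_aff (A : set R) : measurable A ->
  mu A = scaled_pushforward A.
Proof.
move=> mA; apply: lebesgue_measure_unique => //= _ [[c d]] _ <-.
rewrite /mscale/= /pushforward/=.
rewrite (_ : aff @^-1` _ = `](c - b) / a, (d - b) / a]%classic)%R; last first.
  apply/seteqP; split => x /=; rewrite !in_itv/= /aff;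
    by rewrite ltr_pdivrMr// ler_pdivlMr// ltrBlDr lerBrDr mulrC.
rewrite !lebesgue_measure_itv/= !lte_fin ltr_pM2r ?invr_gt0// ltrD2r.
case: ifPn => cd; last by rewrite mule0.
by rewrite -!EFinB -EFinM; congr EFin; field; rewrite gt_eqF.
Qed.

Lemma ge0_integral_affine (f : R -> \bar R) : measurable_fun setT f ->
  (forall x, 0 <= f x) ->
  \int[mu]_x f x = a%:E * \int[mu]_x f (a * x + b)%R.
Proof.
move=> mf f0.
rewrite (eq_measure_integral scaled_pushforward); last first.
  by move=> A mA _; exact: lebesgue_measure_aff.
rewrite ge0_integral_mscale//=.
by rewrite ge0_integral_pushforward.
Qed.

End lebesgue_affine.

(** * Fubini for Lebesgue measure on R^(k+1), splitting off the first coordinate *)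

Section lebesgue_tuple_fubini.
Context {R : realType} {k : nat}.
Local Notation mu := (@lebesgue_measure R).
Local Open Scope ereal_scope.
Variable A : set (k.+1.-tuple R).
Hypothesis mA : measurable A.

Lemma measurable_lebesgue_tuple_section :
  measurable_fun setT
    (fun x => lebesgue_tuple R k [set y : k.-tuple R | A (cons_pair (x, y))]).
Proof.
have mB : measurable (cons_pair @^-1` A).
  by rewrite -[X in measurable X]setTI; exact: measurable_cons_pair.
have := measurable_fun_xsection (lebesgue_tuple R k) mB.
congr (measurable_fun _ _); apply/funext => x /=; congr (lebesgue_tuple R k _).
by apply/seteqP; split => y; rewrite /xsection/= inE.
Qed.

Lemma lebesgue_tupleS : lebesgue_tuple R k.+1 A =
  \int[mu]_x lebesgue_tuple R k [set y : k.-tuple R | A (cons_pair (x, y))].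
Proof.
apply: eq_integral => x _ /=; congr (lebesgue_tuple R k _).
by apply/seteqP; split => y; rewrite /xsection/= inE.
Qed.

(** The product measure is built from sections at a fixed first coordinate; its uniqueness gives the
    other order of integration. *)
Lemma lebesgue_tupleSr : lebesgue_tuple R k.+1 A =
  \int[lebesgue_tuple R k]_y mu [set x : R | A (cons_pair (x, y))].
Proof.
have mB : measurable (cons_pair @^-1` A).
  by rewrite -[X in measurable X]setTI; exact: measurable_cons_pair.
rewrite /= /lebesgue_cons /pushforward.
rewrite (@product_measure_unique _ _ _ _ _ mu (lebesgue_tuple R k)
  (product_measure2 mu (lebesgue_tuple R k)))//; last first.
  by move=> *; exact: product_measure2E.
apply: eq_integral => y _ /=; congr (mu _).
by apply/seteqP; split => x; rewrite /ysection/= inE.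
Qed.

Lemma measurable_lebesgue_tuple_sectionr :
  measurable_fun setT (fun y => mu [set x : R | A (cons_pair (x, y))]).
Proof.
have mB : measurable (cons_pair @^-1` A).
  by rewrite -[X in measurable X]setTI; exact: measurable_cons_pair.
have := measurable_fun_ysection mu mB.
congr (measurable_fun _ _); apply/funext => y /=; congr (mu _).
by apply/seteqP; split => x; rewrite /ysection/= inE.
Qed.

End lebesgue_tuple_fubini.

(** * Volumes of Euclidean balls *)

Section ball_volume.
Context {R : realType}.
Local Notation mu := (@lebesgue_measure R).

Definition sqnorm k (x : k.-tuple R) : R := \sum_(j < k) tnth x j ^+ 2.

Lemma sqnorm_ge0 k (x : k.-tuple R) : 0 <= sqnorm x.
Proof. by apply: sumr_ge0 => i _; exact: sqr_ge0. Qed.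

Lemma sqnorm_cons k (a : R) (x : k.-tuple R) :
  sqnorm (cons_pair (a, x)) = a ^+ 2 + sqnorm x.
Proof.
rewrite /sqnorm big_ord_recl; congr (_ + _).
by apply: eq_bigr => i _; rewrite tnthS.
Qed.

Lemma measurable_sqnorm k : measurable_fun setT (@sqnorm k).
Proof.
by apply: measurable_sum => i; apply: measurable_funX; exact: measurable_tnth.
Qed.

Lemma measurable_sqnorm_le k (s : R) : measurable [set x : k.-tuple R | sqnorm x <= s].
Proof.
rewrite (_ : mkset _ = @sqnorm k @^-1` `]-oo, s]).
  by rewrite -[X in measurable X]setTI; apply: measurable_sqnorm.
by apply/seteqP; split => x /=; rewrite in_itv.
Qed.

(* The argument s is the square of the radius. *)
Definition ball_volume k (s : R) : \bar R :=
  lebesgue_tuple R k [set x | sqnorm x <= s].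

Local Open Scope ereal_scope.

Lemma ball_volume_ge0 k s : 0 <= ball_volume k s.
Proof. exact: measure_ge0. Qed.

Lemma le_ball_volume k s t : (s <= t)%R -> ball_volume k s <= ball_volume k t.
Proof.
move=> st; apply: le_measure; rewrite ?inE; [exact: measurable_sqnorm_le..|].
by move=> x /= /le_trans; apply.
Qed.

Lemma ball_volume_lt0 k s : (s < 0)%R -> ball_volume k s = 0.
Proof.
move=> s0; rewrite /ball_volume (_ : mkset _ = set0) ?measure0//.
apply/seteqP; split => // x /= xs.
by have := sqnorm_ge0 x; rewrite leNgt (le_lt_trans xs).
Qed.

Lemma ball_volume0E s : ball_volume 0 s = (0 <= s)%R%:R%:E.
Proof.
rewrite /ball_volume /= diracE; congr (_%:R%:E); congr nat_of_bool.
by apply/idP/idP; rewrite inE/= /sqnorm big_ord0.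
Qed.

Lemma ball_volumeS k s :
  ball_volume k.+1 s = \int[mu]_x ball_volume k (s - x ^+ 2).
Proof.
rewrite /ball_volume lebesgue_tupleS.
apply: eq_integral => x _; congr (lebesgue_tuple R k _).
by apply/seteqP; split => y /=; rewrite sqnorm_cons lerBrDl.
Qed.

Lemma ball_volume_fin_num k s : ball_volume k s \is a fin_num.
Proof.
rewrite ge0_fin_numE ?ball_volume_ge0//.
(* The cube of half-side 1 + |s| contains the ball for every sign of s, because y^2 <= |s| forces
   |y| <= 1 + |s|. *)
pose I (i : 'I_k) : set R := `[- (1 + `|s|), 1 + `|s|]%classic%R.
have mI i : measurable (I i) by exact: measurable_itv.
apply: (@le_lt_trans _ _ (lebesgue_tuple R k [set x | forall i, I i (tnth x i)])).
  apply: le_measure; rewrite ?inE; first exact: measurable_sqnorm_le.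
    rewrite (_ : mkset _ = \bigcap_(i in [set: 'I_k]) ((@tnth k R)^~ i @^-1` I i)).
      apply: fin_bigcap_measurable; first exact: finite_finset.
      move=> i _; rewrite -[X in measurable X]setTI.
      exact: measurable_tnth.
    by apply/seteqP; split => x /=; [move=> + i _; apply|move=> + i; apply].
  move=> x /= xs i; rewrite /I /= in_itv/= -ler_norml.
  have : (`|tnth x i| ^+ 2 <= `|s|)%R.
    rewrite real_normK ?num_real// (le_trans _ (ler_norm s))//.
    rewrite (le_trans _ xs)// /sqnorm (bigD1 i)//= lerDl.
    by apply: sumr_ge0 => j _; exact: sqr_ge0.
  have := normr_ge0 s; have := normr_ge0 (tnth x i); nra.
rewrite lebesgue_tuple_box//.
rewrite (_ : (\prod_(i < k) _)%E = (\prod_(i < k) (2 * (1 + `|s|)))%R%:E) ?ltry//.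
rewrite -prodEFin; apply: eq_bigr => i _; rewrite /I lebesgue_measure_itv/= lte_fin.
rewrite gtrN ?ltr_pwDl//.
by rewrite -EFinB; congr EFin; ring.
Qed.

Lemma measurable_ball_volume k : measurable_fun setT (ball_volume k).
Proof.
rewrite (_ : ball_volume k = EFin \o (fine \o ball_volume k)); last first.
  by apply/funext => s /=; rewrite fineK ?ball_volume_fin_num.
apply/measurable_EFinP; apply: nondecreasing_measurable => // s t st /=.
by rewrite fine_le ?ball_volume_fin_num// le_ball_volume.
Qed.

Lemma measurable_ball_volume_sub k s :
  measurable_fun setT (fun x : R => ball_volume k (s - x ^+ 2)).
Proof.
apply: (measurableT_comp (@measurable_ball_volume k)).
by apply: measurable_funB => //; exact: measurable_funX.
Qed.

(** By induction on k: substituting r x for x in the slice integral brings out one factor r, and the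
    slice then has squared radius r^2 (s - x^2). *)
Lemma ball_volume_scale k r s : (0 < r)%R ->
  ball_volume k (r ^+ 2 * s) = (r ^+ k)%:E * ball_volume k s.
Proof.
move=> r0; elim: k s => [|k IHk] s.
  by rewrite !ball_volume0E pmulr_rge0 ?exprn_gt0// mul1e.
rewrite !ball_volumeS (ge0_integral_affine 0 r0)/=; last 2 first.
- exact: measurable_ball_volume_sub.
- by move=> x; exact: ball_volume_ge0.
under eq_integral => x _ do
  rewrite addr0 exprMn -mulrBr IHk.
rewrite ge0_integralZl_EFin//; last 2 first.
- exact: measurable_ball_volume_sub.
- by rewrite exprn_ge0// ltW.
by rewrite muleA -EFinM -exprS.
Qed.

Lemma ball_volume_powR k s : (0 < s)%R ->
  ball_volume k s = (s `^ (k%:R / 2))%:E * ball_volume k 1.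
Proof.
move=> s0; have := ball_volume_scale k 1%R (_ : 0 < Num.sqrt s)%R.
rewrite sqrtr_gt0 => /(_ s0); rewrite mulr1 sqr_sqrtr ?ltW// => ->.
by rewrite -powR12_sqrt ?ltW// -powR_mulrn ?powR_ge0// -powRrM mulrC.
Qed.

(** Every slice at x != 0 has negative squared radius, so the slice integrand vanishes off a null
    set. Positive dimension matters: in dimension 0 the value is 1. *)
Lemma ball_volume0 k : ball_volume k.+1 0 = 0.
Proof.
rewrite ball_volumeS -(@integral0 _ _ _ mu setT).
apply: (@ae_eq_integral _ _ _ mu) => //.
  exact: measurable_ball_volume_sub.
exists [set 0%R]; split => //; first exact: lebesgue_measure_set1.
move=> x /= /not_implyP[_]; apply: contra_notP => /eqP x0.
by rewrite ball_volume_lt0// sub0r oppr_lt0 exprn_even_gt0.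
Qed.

(** With K = k + 2, the slices of the larger ball at |x| <= 1/K contain a k-dimensional ball of
    squared radius 1 - 1/K^2, whose volume is at least half that of the unit ball. These x fill an
    interval of length 2/K, and 2/K * 1/2 = 1/K. *)
Lemma le_ball_volumeS k :
  ball_volume k 1 <= k.+2%:R%:E * ball_volume k.+1 1.
Proof.
rewrite -[in leRHS]addn2 natrD; set K : R := (k%:R + 2)%R.
have K2 : (2 <= K)%R by rewrite lerDr.
have K0 : (0 < K)%R by exact: lt_le_trans K2.
have K1 : (0 < K^-1 <= 2^-1)%R.
  by rewrite invr_gt0 K0 lef_pV2// posrE.
pose z : R := (K^-1 ^+ 2)%R.
have [z0 z4] : (0 <= z /\ z <= 4^-1)%R.
  rewrite /z; case/andP: K1; move: (K^-1)%R => y y0 y2; split; nra.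
have kz : (k%:R * z <= 2^-1)%R.
  have -> : (k%:R = K - 2 :> R)%R by rewrite addrK.
  rewrite mulrBl {1}/z expr2 mulrA divff ?gt_eqF// mul1r.
  by case/andP: K1 => _; lra.
have bernoulli n : (1 - n%:R * z <= (1 - z) ^+ n)%R.
  elim: n => [|n IHn]; first by rewrite expr0 mul0r subr0.
  rewrite exprS -natr1.
  have := ler_wpM2l (_ : 0 <= 1 - z)%R IHn.
  have := mulr_ge0 (ler0n R n) (mulr_ge0 z0 z0).
  by move: ((1 - z) ^+ n)%R => y nz /(_ _); lra.
(* The base lies in ]0, 1], so raising the exponent from k/2 to k only decreases the power;
   Bernoulli and k z <= 1/2 conclude. *)
have half : (2^-1 <= (1 - z) `^ (k%:R / 2))%R.
  rewrite (@le_trans _ _ ((1 - z) `^ k%:R))%R//; last first.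
    rewrite ger_powR//; first by apply/andP; split; lra.
    by rewrite ler_pdivrMr// ler_peMr// ler1n.
  rewrite powR_mulrn; last by lra.
  by apply: le_trans (bernoulli k); lra.
rewrite ball_volumeS.
apply: (@le_trans _ _ (K%:E *
    \int[mu]_(x in `[(- K^-1)%R, (K^-1)%R]) ((2^-1)%:E * ball_volume k 1))).
  rewrite integral_cst//= lebesgue_measure_itv/= lte_fin gtrN; last by case/andP: K1.
  rewrite muleCA -EFinB -EFinM muleAC -EFinM.
  rewrite (_ : _ * _ = 1)%R ?mul1e//.
  by field; rewrite gt_eqF.
rewrite lee_pmul2l ?lte_fin//; apply: (@le_trans _ _
    (\int[mu]_(x in `[(- K^-1)%R, (K^-1)%R]) ball_volume k (1 - x ^+ 2))).
  apply: ge0_le_integral => //.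
  - by move=> x _; rewrite mule_ge0 ?ball_volume_ge0// lee_fin.
  - by apply: measurable_funTS; exact: measurable_ball_volume_sub.
  move=> x; rewrite /= in_itv/= => /andP[Kx xK].
  rewrite (@le_trans _ _ (ball_volume k (1 - z)))//; last first.
    by rewrite le_ball_volume// lerD2l lerN2 /z; nra.
  rewrite (ball_volume_powR _ (_ : 0 < 1 - z)%R); last by lra.
  by rewrite lee_wpmul2r ?ball_volume_ge0.
apply: ge0_subset_integral => //.
exact: measurable_ball_volume_sub.
Qed.

Lemma ball_volume_gt0 k : 0 < ball_volume k 1.
Proof.
elim: k => [|k IHk]; first by rewrite ball_volume0E ler01.
have := lt_le_trans IHk (le_ball_volumeS k).
by rewrite pmule_rgt0// lte_fin.
Qed.

End ball_volume.

(** * Volume of the part of a ball where a real linear form is small *)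

Section slab.
Context {R : realType}.
Local Notation mu := (@lebesgue_measure R).

(** The shift [c] makes the family stable under slicing: a fixed coordinate contributes a constant
    to the linear form. As for balls, [s] is a squared radius. *)
Definition slab k (p : 'I_k -> R) (c s t : R) : set (k.-tuple R) :=
  [set x | sqnorm x <= s /\ `|\sum_i p i * tnth x i + c| <= t].

Lemma slab_cons k (p : 'I_k.+1 -> R) c s t x (y : k.-tuple R) :
  slab p c s t (cons_pair (x, y)) <->
  slab (p \o lift ord0) (p ord0 * x + c) (s - x ^+ 2) t y.
Proof.
rewrite /slab/= sqnorm_cons lerBrDl big_ord_recl.
rewrite -[tnth _ ord0]/x -addrA addrCA.
rewrite (eq_bigr (fun i => (p \o lift ord0) i * tnth y i))// => i _.
by rewrite tnthS.
Qed.

Lemma measurable_slab k (p : 'I_k -> R) c s t : measurable (slab p c s t).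
Proof.
apply: measurableI; first exact: measurable_sqnorm_le.
pose f (x : k.-tuple R) := `|\sum_i p i * tnth x i + c|.
rewrite [X in measurable X](_ : _ = f @^-1` `]-oo, t]).
  rewrite -[X in measurable X]setTI.
  suff : measurable_fun setT f by apply.
  apply: (measurableT_comp (@normr_measurable R setT)).
  apply: measurable_funD => //; apply: measurable_sum => i.
  by apply: measurable_funM => //; exact: measurable_tnth.
by apply/seteqP; split => x /=; rewrite in_itv.
Qed.

Local Open Scope ereal_scope.

Lemma slab1_itv (p d t : R) : p != 0%R ->
  [set x | `|p * x + d| <= t]%R =
  `[(- (d / p) - t / `|p|)%R, (- (d / p) + t / `|p|)%R]%classic.
Proof.
move=> p0; have p_gt0 : (0 < `|p|)%R by rewrite normr_gt0.
apply/seteqP; split => x /=; rewrite in_itv/= -ler_distl opprK;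
  by rewrite ler_pdivlMr// -normrM mulrDl divfK// mulrC.
Qed.

Lemma lebesgue_measure_slab1 (p d t : R) : p != 0%R -> (0 <= t)%R ->
  `|p|%:E * mu [set x | `|p * x + d| <= t]%R = (2 * t)%:E.
Proof.
move=> p0 t0; have p_gt0 : (0 < `|p|)%R by rewrite normr_gt0.
rewrite slab1_itv// lebesgue_measure_itv/= lte_fin ltrD2l.
  rewrite -EFinB; have -> : (- (d / p) + t / `|p| - (- (d / p) - t / `|p|) = 2 * (t / `|p|))%R.
    by ring.
  have : (0 <= t / `|p|)%R by rewrite divr_ge0.
  rewrite le_eqVlt => /orP[/eqP tp|tp]; last first.
    by rewrite gtrN// -EFinM mulrCA (mulrC `|p|%R) divfK// gt_eqF.
  have -> : t = 0%R by apply/eqP; move/esym/eqP: tp; rewrite mulf_eq0 invr_eq0 (gt_eqF p_gt0) orbF.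
  by rewrite mul0r oppr0 ltxx mule0 mulr0.
Qed.

(** Once the other coordinates y are fixed, the first one is confined to an interval of length 2t /
    |p_0|, and y itself stays in the ball of squared radius s. Keeping |p_0| on the left makes the
    case p_0 = 0 trivial. *)
Lemma lebesgue_tuple_slab0 k (p : 'I_k.+1 -> R) c s t : (0 <= t)%R ->
  `|p ord0|%:E * lebesgue_tuple R k.+1 (slab p c s t) <=
  (2 * t)%:E * ball_volume k s.
Proof.
move=> t0; have t20 : (0 <= 2 * t)%R by rewrite mulr_ge0.
have [p0|p0] := eqVneq (p ord0) 0%R.
  by rewrite p0 normr0 mul0e mule_ge0 ?ball_volume_ge0.
have mS := measurable_slab p c s t.
have mB := @measurable_sqnorm_le R k s.
rewrite lebesgue_tupleSr//.
have mF : measurable_fun setT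
    (fun y : k.-tuple R => mu [set x : R | slab p c s t (cons_pair (x, y))]).
  exact: measurable_lebesgue_tuple_sectionr.
rewrite -ge0_integralZl_EFin//.
have -> : (2 * t)%:E * ball_volume k s =
    \int[lebesgue_tuple R k]_(y in [set y | (sqnorm y <= s)%R]) (2 * t)%:E.
  by rewrite integral_cst.
rewrite [leRHS]integral_mkcond.
apply: ge0_le_integral => //=.
- by move=> y _; rewrite mule_ge0.
- exact: measurable_funeM.
- by apply/(measurable_restrictT _ _).1.
move=> y _; rewrite patchE; case: ifPn => [_|].
  rewrite -(@lebesgue_measure_slab1 (p ord0)
    (\sum_(i < k) (p \o lift ord0) i * tnth y i + c)%R t p0 t0)//.
  rewrite lee_wpmul2l//; apply: le_measure; rewrite ?inE.
  - have mfS : measurable (cons_pair @^-1` slab p c s t).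
      by rewrite -[X in measurable X]setTI; exact: measurable_cons_pair.
    have := measurable_ysection y mfS; congr measurable.
    by apply/seteqP; split => x; rewrite /ysection/= inE.
  - by rewrite slab1_itv//; exact: measurable_itv.
  - by move=> x /slab_cons[_] /=; rewrite addrCA.
rewrite notin_setE/= => ys; rewrite [X in mu X](_ : _ = set0) ?measure0 ?mule0//.
apply/seteqP; split => // x /slab_cons[xys _]; apply: ys.
by rewrite (le_trans xys)// gerBl sqr_ge0.
Qed.

(* If j is the first coordinate, integrate over it first; otherwise fix the
   first coordinate and use the induction hypothesis on the slices. *)
Lemma lebesgue_tuple_slab k (p : 'I_k.+1 -> R) j c s t : (0 <= t)%R ->
  `|p j|%:E * lebesgue_tuple R k.+1 (slab p c s t) <=
  (2 * t)%:E * ball_volume k s.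
Proof.
move=> t0; have t20 : (0 <= 2 * t)%R by rewrite mulr_ge0.
elim: k p j c s => [|k IHk] p j c s.
  by rewrite ord1 lebesgue_tuple_slab0.
have [i ->|->] := unliftP ord0 j; last exact: lebesgue_tuple_slab0.
have mS := measurable_lebesgue_tuple_section (measurable_slab p c s t).
have mB := @measurable_ball_volume_sub R k s.
rewrite lebesgue_tupleS -ge0_integralZl_EFin//.
rewrite ball_volumeS -ge0_integralZl_EFin//.
apply: ge0_le_integral => //=.
- by move=> x _; rewrite mule_ge0.
- exact: measurable_funeM.
- exact: measurable_funeM.
move=> x _; rewrite (_ : [set y | _] =
    slab (p \o lift ord0) (p ord0 * x + c) (s - x ^+ 2) t).
  exact: (IHk (p \o lift ord0)).
by apply/seteqP; split => y /slab_cons.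
Qed.

End slab.

(** * The Gamma integral and its link with ball volumes *)

Section gamma_integral.
Context {R : realType}.
Local Notation mu := (@lebesgue_measure R).
Local Open Scope ereal_scope.

(** [Gamma] is the finite part of this extended real; identities can thus be proved by Tonelli
    before finiteness is known. *)
Definition gamma_integral (x : R) : \bar R :=
  \int[mu]_(t in `]0%R, +oo[) (t `^ (x - 1) * expR (- t))%:E.

Lemma exponential_pdf1E (t : R) :
  exponential_pdf 1 t = ((0 <= t)%R%:R * expR (- t))%R.
Proof.
rewrite /exponential_pdf patchE; case: ifPn; rewrite ?notin_setE ?inE/= in_itv/= andbT.
  by move=> ->; rewrite mulN1r.
by move=> /negP/negbTE ->; rewrite mul0r.
Qed.

Lemma exponential_pdf1_shift (s t : R) :
  (expR (- s) * exponential_pdf 1 (t - s) = (s <= t)%R%:R * expR (- t))%R.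
Proof.
by rewrite exponential_pdf1E subr_ge0 mulrCA -expRD; congr (_ * expR _)%R; ring.
Qed.

Lemma integral_powR (x t : R) : (1 <= x)%R -> (0 <= t)%R ->
  \int[mu]_(s in `[0%R, t]) (x * s `^ (x - 1))%:E = (t `^ x)%:E.
Proof.
move=> x1; have x0 : (0 < x)%R by exact: lt_le_trans x1.
have xN0 : x != 0%R by rewrite gt_eqF.
rewrite le_eqVlt => /orP[/eqP <-|t0].
  by rewrite set_itv1 integral_set1 powR0.
have cvgp (y a : R) : (0 < a)%R -> ((s : R) `^ y @[s --> a] --> a `^ y)%R.
  move=> a0; apply: (@differentiable_continuous _ R^o R^o a (@powR R ^~ y)).
  apply/derivable1_diffP.
  by apply: derivable_powR; rewrite in_itv/= a0.
(* Exponent 0 occurs when x = 1; the power is then constantly 1, also at the endpoint 0. *)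
have cvgp0 (y : R) : (0 <= y)%R -> ((s : R) `^ y @[s --> 0^'+] --> 0 `^ y)%R.
  rewrite le_eqVlt => /orP[/eqP <-|y0].
    under eq_fun do rewrite powRr0.
    by rewrite powRr0; exact: cvg_cst.
  by rewrite powR0 ?gt_eqF//; exact: powR_cvg0.
rewrite (@continuous_FTC2 _ _ (@powR R ^~ x)) ?powR0 ?sube0//.
- apply/continuous_within_itvP => //; split.
  + move=> s /[!in_itv]/= /andP[s0 _]; apply: cvgM; first exact: cvg_cst.
    exact: cvgp.
  + by apply: cvgM; [exact: cvg_cst|apply: cvgp0; rewrite subr_ge0].
  + by apply: cvgM; [exact: cvg_cst|apply: cvg_at_left_filter; exact: cvgp].
- split.
  + move=> s /[!in_itv]/= /andP[s0 _].
    by apply: derivable_powR; rewrite in_itv/= s0.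
  + by apply: cvgp0; rewrite ltW.
  + by apply: cvg_at_left_filter; exact: cvgp.
- move=> s /[!in_itv]/= /andP[s0 _].
  by rewrite powR_derive1// in_itv/= s0.
Qed.

Lemma gamma_integral_closed x : gamma_integral x =
  \int[mu]_(t in `[0%R, +oo[) (t `^ (x - 1) * expR (- t))%:E.
Proof.
apply: integral_itv_obnd_cbnd; apply: measurable_funTS; apply/measurable_EFinP.
apply: measurable_funM; first exact: measurable_powR.
by apply: measurableT_comp => //; exact: measurableT_comp.
Qed.

Lemma integral_exponential_pdf_shift (s : R) :
  \int[mu]_t (exponential_pdf 1 (t - s))%:E = 1.
Proof.
rewrite (ge0_integral_affine s ltr01)/=; last 2 first.
- apply/measurable_EFinP; apply: measurableT_comp.
    exact: measurable_exponential_pdf.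
  exact: measurable_funB.
- by move=> t; rewrite lee_fin exponential_pdf_ge0.
rewrite mul1e -[RHS](@integral_exponential_pdf R 1)//.
by apply: eq_integral => t _; rewrite mul1r addrK.
Qed.

(* Tonelli's theorem for x s^(x-1) exp(-t) on the domain 0 <= s <= t, with
   exp(-t) written exp(-s) exp(-(t-s)). *)
Lemma gamma_integralS x : (1 <= x)%R ->
  gamma_integral (x + 1) = x%:E * gamma_integral x.
Proof.
move=> x1; have x0 : (0 < x)%R by exact: lt_le_trans x1.
pose g : R -> R := (fun s => x * s `^ (x - 1))%R \_ `[0%R, +oo[.
have mg : measurable_fun setT g.
  apply/(measurable_restrictT _ _).1 => //; apply: measurable_funTS.
  by apply: measurable_funM => //; exact: measurable_powR.
have g0 s : (0 <= g s)%R.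
  by apply: restrict_ge0 => {}s _; rewrite mulr_ge0 ?powR_ge0// ltW.
pose F (z : R * R) := (g z.2 * (expR (- z.2) * exponential_pdf 1 (z.1 - z.2)))%:E.
have mF : measurable_fun setT F.
  apply/measurable_EFinP; apply: measurable_funM.
    by apply: measurableT_comp => //; exact: measurable_snd.
  apply: measurable_funM.
    by do 2 apply: measurableT_comp => //; exact: measurable_snd.
  apply: measurableT_comp; first exact: measurable_exponential_pdf.
  by apply: measurable_funB; [exact: measurable_fst|exact: measurable_snd].
have F0 z : 0 <= F z.
  by rewrite lee_fin mulr_ge0// mulr_ge0 ?expR_ge0// exponential_pdf_ge0.
have := @fubini_tonelli _ _ _ _ R mu mu F mF F0.
(* Integrating over s first turns x s^(x-1) on [0, t] into t^x. *)
have -> : \int[mu]_t \int[mu]_s F (t, s) = gamma_integral (x + 1).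
  rewrite gamma_integral_closed addrK [RHS]integral_mkcond; apply: eq_integral => t _.
  transitivity (\int[mu]_s ((expR (- t))%:E *
      ((fun s => (x * s `^ (x - 1))%:E) \_ `[0%R, t]) s)).
    apply: eq_integral => s _.
    rewrite /F/= exponential_pdf1_shift /g !patchE !mem_setE !in_itv/= andbT.
    by case: (0 <= s)%R; case: (s <= t)%R; rewrite ?mule0 ?mul0r ?mulr0//= mul1r -EFinM mulrC.
  rewrite ge0_integralZl_EFin//; last 2 first.
  - move=> s _; apply: erestrict_ge0 => {}s _.
    by rewrite lee_fin mulr_ge0 ?powR_ge0// ltW.
  - apply/(measurable_restrictT _ _).1 => //; apply: measurable_funTS.
    apply/measurable_EFinP; exact: measurable_funM.
  rewrite -integral_mkcond patchE mem_setE in_itv/= andbT; case: leP => t0.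
    by rewrite integral_powR// -EFinM mulrC.
  by rewrite set_itv_ge ?integral_set0 ?mule0// bnd_simp -ltNge.
(* In the other order, the t-integral is the total mass 1 of an exponential density started at s. *)
move=> ->; rewrite gamma_integral_closed -ge0_integralZl_EFin//; last 3 first.
- by move=> t _; rewrite lee_fin mulr_ge0 ?powR_ge0 ?expR_ge0.
- apply: measurable_funTS; apply/measurable_EFinP.
  apply: measurable_funM; first exact: measurable_powR.
  by apply: measurableT_comp => //; exact: measurableT_comp.
- by rewrite ltW.
rewrite [RHS]integral_mkcond; apply: eq_integral => s _.
under eq_integral => t _ do rewrite /F/= mulrA EFinM.
rewrite ge0_integralZl_EFin//; last 3 first.
- by move=> t _; rewrite lee_fin exponential_pdf_ge0.
- apply/measurable_EFinP; apply: measurableT_comp.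
    exact: measurable_exponential_pdf.
  exact: measurable_funB.
- by rewrite mulr_ge0 ?expR_ge0.
rewrite integral_exponential_pdf_shift mule1 /g !patchE.
by case: ifPn => _; rewrite ?mul0r// -EFinM mulrA.
Qed.

(** Slicing the ball at x and shifting t by x^2 splits off the factor exp(-x^2), whose integral is
    sqrt(pi). In dimension 0 the volume is the indicator of t >= 0, which leaves the exponential
    density. *)
Lemma integral_exp_ball_volume k :
  \int[mu]_t ((expR (- t))%:E * ball_volume k t) = (Num.sqrt pi ^+ k)%:E.
Proof.
have mb m (s : R) : measurable_fun setT
    (fun t : R => (expR (- t))%:E * ball_volume m (t - s)).
  apply: emeasurable_funM.
    by apply/measurable_EFinP; do 2 apply: measurableT_comp => //.
  apply: (measurableT_comp (@measurable_ball_volume R m)).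
  exact: measurable_funB.
elim: k => [|k IHk].
  rewrite expr0 -[RHS](integral_exponential_pdf_shift 0).
  apply: eq_integral => t _.
  by rewrite subr0 exponential_pdf1E ball_volume0E -EFinM mulrC.
pose F (z : R * R) := (expR (- z.1))%:E * ball_volume k (z.1 - z.2 ^+ 2).
have mF : measurable_fun setT F.
  apply: emeasurable_funM.
    apply/measurable_EFinP; do 2 apply: measurableT_comp => //.
  apply: (measurableT_comp (@measurable_ball_volume R k)).
  by apply: measurable_funB => //; apply: measurable_funX.
have F0 z : 0 <= F z by rewrite mule_ge0 ?ball_volume_ge0// lee_fin expR_ge0.
transitivity (\int[mu]_t \int[mu]_x F (t, x)).
  apply: eq_integral => t _; rewrite ball_volumeS -ge0_integralZl_EFin//.
  exact: measurable_ball_volume_sub.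
rewrite fubini_tonelli//.
transitivity (\int[mu]_x ((Num.sqrt pi ^+ k)%:E * (gauss_fun x)%:E)).
  apply: eq_integral => x _; rewrite /F/=.
  rewrite (ge0_integral_affine (x ^+ 2)%R ltr01)/=; last 2 first.
  - exact: mb.
  - by move=> t; rewrite mule_ge0 ?ball_volume_ge0// lee_fin expR_ge0.
  rewrite mul1e muleC -IHk -ge0_integralZl_EFin//; last 3 first.
  - by move=> t _; rewrite mule_ge0 ?ball_volume_ge0// lee_fin expR_ge0.
  - by have := mb k 0%R; under eq_fun do rewrite subr0.
  - exact: gauss_fun_ge0.
  apply: eq_integral => t _.
  by rewrite mul1r addrK opprD expRD mulrC EFinM -muleA.
rewrite ge0_integralZl_EFin//.
- by rewrite integralT_gauss -EFinM exprSr.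
- by move=> x _; rewrite lee_fin gauss_fun_ge0.
by apply/measurable_EFinP; exact: measurable_gauss_fun.
Qed.

(** By homogeneity the ball of squared radius t > 0 contributes the factor t^((k+1)/2), which turns
    the preceding integral into a Gamma integral; for t <= 0 the volume is 0. *)
Lemma ball_volume_gamma k :
  ball_volume k.+1 1 * gamma_integral (k.+1%:R / 2 + 1) =
  (Num.sqrt pi ^+ k.+1)%:E.
Proof.
rewrite -integral_exp_ball_volume /gamma_integral addrK.
have := ball_volume_fin_num k.+1 (1 : R); move: (ball_volume_ge0 k.+1 (1 : R)).
case E : (ball_volume k.+1 1) => [V| |]// V0 _.
rewrite -ge0_integralZl_EFin//; last 2 first.
- by move=> t _; rewrite lee_fin mulr_ge0 ?powR_ge0 ?expR_ge0.
- apply: measurable_funTS; apply/measurable_EFinP.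
  apply: measurable_funM; first exact: measurable_powR.
  by apply: measurableT_comp => //; exact: measurableT_comp.
rewrite [LHS]integral_mkcond; apply: eq_integral => t _.
rewrite patchE mem_setE in_itv/= andbT; case: ltgtP => t0.
- by rewrite (ball_volume_powR _ t0) E -!EFinM; congr EFin; ring.
- by rewrite ball_volume_lt0 ?mule0.
- by rewrite -t0 ball_volume0 mule0.
Qed.

End gamma_integral.

(** * Total mass of the sphere, and the measure of the set where the pairing is small *)

Section surface.
Context {R : realType}.
Local Notation mu := (@lebesgue_measure R).

Lemma enormE k (x : k.-tuple R) : enorm x = Num.sqrt (sqnorm x).
Proof. by []. Qed.

Lemma punctured_ballE k : punctured_ball R k =
  [set x | sqnorm x <= 1] `\` [set x | sqnorm x <= 0].
Proof.
apply/seteqP; split => x; rewrite /punctured_ball/= enormE sqrtr_gt0.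
  move=> /andP[x0 x1]; split; last by apply/negP; rewrite -ltNge.
  by rewrite -(@ler_sqrt _ _ 1)// sqrtr1.
by move=> [x1 /negP]; rewrite -ltNge => ->; rewrite -[leRHS]sqrtr1 ler_sqrt.
Qed.

Lemma enorm_normalize k (x : k.-tuple R) : 0 < enorm x -> enorm (normalize x) = 1.
Proof.
move=> x0; rewrite enormE /sqnorm.
under eq_bigr do rewrite tnth_map exprMn.
rewrite -mulr_suml sqrtrM ?sqnorm_ge0// exprVn sqrtrV ?sqr_ge0// sqrtr_sqr.
by rewrite (ger0_norm (ltW x0)) divff// gt_eqF.
Qed.

Lemma cone_unit_sphere k : cone (unit_sphere R k) = punctured_ball R k.
Proof.
rewrite /cone setIidr// => x /andP[x0 _]; exact: enorm_normalize.
Qed.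

Local Open Scope ereal_scope.

Lemma lebesgue_punctured_ball k : (0 < k)%N ->
  lebesgue_tuple R k (punctured_ball R k) = ball_volume k 1.
Proof.
case: k => // k _; rewrite punctured_ballE measureD//; last 3 first.
- exact: measurable_sqnorm_le.
- exact: measurable_sqnorm_le.
- by rewrite -ge0_fin_numE ?ball_volume_fin_num// ball_volume_ge0.
rewrite setIidr; last by move=> x /= /le_trans; apply.
by rewrite [X in _ - X]ball_volume0 sube0.
Qed.

(** The recurrence for Gamma turns the preceding identity into V_k (k/2) Gamma(k/2) = pi^(k/2); it
    applies because k >= 2 gives k/2 >= 1. *)
Lemma sphere_areaE k : (2 <= k)%N ->
  (sphere_area R k)%:E = k%:R%:E * ball_volume k 1.
Proof.
move=> k2; have k0 : (0 < k%:R :> R)%R by rewrite ltr0n (leq_trans _ k2).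
have := ball_volume_gamma (R := R) k.-1; rewrite prednK ?(leq_trans _ k2)//.
rewrite gamma_integralS; last by rewrite ler_pdivlMr// mul1r ler_nat.
rewrite (_ : Num.sqrt pi ^+ k = pi `^ (k%:R / 2))%R; last first.
  by rewrite -powR12_sqrt ?pi_ge0// -powR_mulrn ?powR_ge0// -powRrM mulrC.
rewrite /sphere_area -[Gamma _]/(fine (gamma_integral (k%:R / 2))).
have := ball_volume_fin_num k (1 : R); have := ball_volume_gt0 (R := R) k.
case: (ball_volume k 1) => // V V0 _.
rewrite lte_fin in V0.
(* The product identity has a positive finite right-hand side, which excludes the values 0 and
   infinity for the Gamma integral. *)
case: (gamma_integral _) => [g| |]/=.
- rewrite -!EFinM => -[VE]; congr EFin.
  have g0 : g != 0%R.
    apply/eqP => g0; move: VE; rewrite g0 !mulr0 => /esym/eqP.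
    by rewrite gt_eqF// powR_gt0// pi_gt0.
  by rewrite -VE; field.
- by rewrite gt0_muley ?lte_fin ?divr_gt0// gt0_muley.
- by rewrite gt0_muleNy ?lte_fin ?divr_gt0// gt0_muleNy.
Qed.

Lemma surface_measure_unit_sphere k : (2 <= k)%N ->
  surface_measure (unit_sphere R k) = (sphere_area R k)%:E.
Proof.
move=> k2; rewrite sphere_areaE// /surface_measure cone_unit_sphere.
by rewrite lebesgue_punctured_ball// (leq_trans _ k2).
Qed.

(** The factors k cancel: the measure of E is the proportion of the unit ball filled by the cone
    over E. *)
Lemma normalized_surface_measureE k (E : set (k.-tuple R)) : (2 <= k)%N ->
  normalized_surface_measure R k E =
  (fine (ball_volume k 1 : \bar R))^-1%:E * lebesgue_tuple R k (cone E).
Proof.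
move=> k2; rewrite /normalized_surface_measure /mscale/= /surface_measure muleA.
congr (_ * _); rewrite -EFinM; congr EFin.
have := sphere_areaE k2.
have := ball_volume_fin_num k (1 : R); have := ball_volume_gt0 (R := R) k.
case: (ball_volume k 1) => // V V0 _ /=; rewrite lte_fin in V0.
rewrite -EFinM => -[->].
by field; rewrite gt_eqF//= pnatr_eq0 -lt0n (leq_trans _ k2).
Qed.


Local Close Scope ereal_scope.

Definition abs_pairing k (u : k.-tuple R[i]) (a : k.-tuple R) : R :=
  Normc.normc (pairing (real_tuple a) u).

Lemma abs_pairingE k (u : k.-tuple R[i]) (a : k.-tuple R) : abs_pairing u a =
  Num.sqrt ((\sum_(j < k) complex.Re (tnth u j) * tnth a j) ^+ 2 +
            (\sum_(j < k) complex.Im (tnth u j) * tnth a j) ^+ 2).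
Proof.
rewrite /abs_pairing /pairing.
rewrite [X in Normc.normc X](_ : _ =
  Complex (\sum_(j < k) complex.Re (tnth u j) * tnth a j)
          (\sum_(j < k) complex.Im (tnth u j) * tnth a j))//.
rewrite [RHS](_ : _ = \sum_(j < k) Complex (complex.Re (tnth u j) * tnth a j)
                                  (complex.Im (tnth u j) * tnth a j)).
  apply: eq_bigr => j _; rewrite tnth_map; case: (tnth u j) => x y.
  by apply/eqP; rewrite eq_complex/= !mul0r subr0 addr0 !(mulrC (tnth a j)) !eqxx.
by elim/big_rec3: _ => // j x y z _ <-.
Qed.

Lemma measurable_abs_pairing k (u : k.-tuple R[i]) :
  measurable_fun setT (fun a => abs_pairing u a).
Proof.
under eq_fun do rewrite abs_pairingE.
apply: (measurableT_comp (f := @Num.sqrt R)).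
  exact: (@continuous_measurable_fun R (@Num.sqrt R) (@sqrt_continuous R)).
apply: measurable_funD; apply: measurable_funX; apply: measurable_sum => i;
  by apply: measurable_funM => //; exact: measurable_tnth.
Qed.

Lemma cnorm1_sum k (u : k.-tuple R[i]) : cnorm u = 1 ->
  \sum_(j < k) (complex.Re (tnth u j) ^+ 2 + complex.Im (tnth u j) ^+ 2) = 1.
Proof.
rewrite /cnorm => u1.
have -> : \sum_(j < k) (complex.Re (tnth u j) ^+ 2 + complex.Im (tnth u j) ^+ 2)
    = complex.Re (pairing u (conj_tuple u)).
  rewrite /pairing (raddf_sum (@complex.Re R)).
  apply: eq_bigr => j _; rewrite tnth_map; case: (tnth u j) => x y /=.
  by rewrite mulrN opprK.
have : 0 < Num.sqrt (complex.Re (pairing u (conj_tuple u))) by rewrite u1.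
by rewrite sqrtr_gt0 => /ltW/sqr_sqrtr <-; rewrite u1 expr1n.
Qed.

(** The vector p is the real or the imaginary part of u; since a is real, its pairing with p is one
    of the two parts of <a, u>. *)
Lemma cnorm1_coord k (u : k.+1.-tuple R[i]) : cnorm u = 1 ->
  exists p : 'I_k.+1 -> R, exists j, (2 * k.+1%:R)^-1 <= `|p j| /\
    forall a, `|\sum_j p j * tnth a j| <= abs_pairing u a.
Proof.
move=> /cnorm1_sum u1; set K : R := k.+1%:R.
have K1 : 1 <= K by rewrite ler1n.
have [j uj] : exists j, (2 * K)^-1 <= `|complex.Re (tnth u j)| \/
                        (2 * K)^-1 <= `|complex.Im (tnth u j)|.
  apply: contrapT => /forallNP H.
  suff : 1 < 1 :> R by rewrite ltxx.
  (* If both parts of every coordinate were below z = 1/(2K) <= 1/2, each term would be at most 2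
     z^2 <= z, for a total of at most 1/2. *)
  rewrite -{1}u1 (@le_lt_trans _ _ (\sum_(j < k.+1) (2 * K)^-1))//.
    apply: ler_sum => j _; have /not_orP[/negP + /negP] := H j.
    rewrite -!ltNge -[in leLHS](@real_normK _ (complex.Re _)) ?num_real//.
    rewrite -[in leLHS](@real_normK _ (complex.Im _)) ?num_real//.
    have : (2 * K)^-1 <= 2^-1 by rewrite lef_pV2 ?posrE ?mulr_gt0 ?(lt_le_trans _ K1)//; lra.
    move: (normr_ge0 (complex.Re (tnth u j))) (normr_ge0 (complex.Im (tnth u j))).
    move: (`|complex.Re _|) (`|complex.Im _|) ((2 * K)^-1) => x y z; nra.
  rewrite sumr_const card_ord -[ltLHS]mulr_natr -/K invfM mulfVK; first by lra.
  by rewrite gt_eqF// (lt_le_trans _ K1).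
case: uj => uj; [exists (fun j => complex.Re (tnth u j))|exists (fun j => complex.Im (tnth u j))];
  exists j; split => // a; rewrite abs_pairingE -sqrtr_sqr ler_wsqrtr//.
- by rewrite lerDl sqr_ge0.
- by rewrite lerDr sqr_ge0.
Qed.

Lemma unit_sphere_sqnorm k (a : k.-tuple R) : unit_sphere R k a -> sqnorm a = 1.
Proof.
rewrite /unit_sphere/= enormE => a1.
by rewrite -[LHS]sqr_sqrtr ?sqnorm_ge0// a1 expr1n.
Qed.

Lemma normr_le1_sqr (x : R) : x ^+ 2 <= 1 -> `|x| <= 1.
Proof. by move=> x1; rewrite -(@expr_le1 _ 2)// real_normK// num_real. Qed.

Lemma unit_sphere_coord_le1 k (a : k.-tuple R) j :
  unit_sphere R k a -> `|tnth a j| <= 1.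
Proof.
move=> /unit_sphere_sqnorm a1; apply: normr_le1_sqr.
by rewrite -a1 /sqnorm (bigD1 j)//= lerDl sumr_ge0// => i _; exact: sqr_ge0.
Qed.

Lemma cnorm1_coord_le1 k (u : k.-tuple R[i]) j : cnorm u = 1 ->
  `|complex.Re (tnth u j)| <= 1 /\ `|complex.Im (tnth u j)| <= 1.
Proof.
move=> /cnorm1_sum u1.
have u1' : complex.Re (tnth u j) ^+ 2 + complex.Im (tnth u j) ^+ 2 <= 1.
  rewrite -u1 (bigD1 j)//= lerDl sumr_ge0// => i _.
  by rewrite addr_ge0 ?sqr_ge0.
split; apply: normr_le1_sqr; rewrite (le_trans _ u1')//.
- by rewrite lerDl sqr_ge0.
- by rewrite lerDr sqr_ge0.
Qed.

(** All coordinates have modulus parts at most 1, so both parts of the pairing are at most k and 2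
    k^2 <= k^4. This crude bound is exp(L) at the scale L = 2 log k. *)
Lemma abs_pairing_le k (u : k.-tuple R[i]) (a : k.-tuple R) : (2 <= k)%N ->
  cnorm u = 1 -> unit_sphere R k a -> abs_pairing u a <= k%:R ^+ 2.
Proof.
move=> k2 u1 a1.
have bound (p : 'I_k -> R) : (forall j, `|p j| <= 1) ->
    `|\sum_j p j * tnth a j| <= k%:R.
  move=> p1; rewrite (le_trans (ler_norm_sum _ _ _))//.
  rewrite -[leRHS]mulr1 mulr_natl -[k in leRHS]card_ord -sumr_const ler_sum// => j _.
  by rewrite normrM mulr_ile1// unit_sphere_coord_le1.
rewrite abs_pairingE -[leRHS]ger0_norm ?sqr_ge0// -sqrtr_sqr ler_wsqrtr//.
have := bound _ (fun j => (cnorm1_coord_le1 j u1).1).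
have := bound _ (fun j => (cnorm1_coord_le1 j u1).2).
have : 2 <= k%:R :> R by rewrite ler_nat.
rewrite -[X in X + _](@real_normK _ (\sum_j _)) ?num_real//.
rewrite -[X in _ + X](@real_normK _ (\sum_j _)) ?num_real//.
have := normr_ge0 (\sum_(j < k) complex.Re (tnth u j) * tnth a j).
have := normr_ge0 (\sum_(j < k) complex.Im (tnth u j) * tnth a j).
move: (`|_|) (`|_|) k%:R => y x z y0 x0 z2 yz xz.
have xx : x ^+ 2 <= z ^+ 2 by nra.
have yy : y ^+ 2 <= z ^+ 2 by nra.
have zz : 4 <= z ^+ 2 by nra.
nra.
Qed.

Lemma measurable_unit_sphere k : measurable (unit_sphere R k).
Proof.
rewrite (_ : unit_sphere R k = @enorm R k @^-1` [set 1])//.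
by rewrite -[X in measurable X]setTI; apply: measurable_enorm.
Qed.

Lemma measurable_abs_pairing_le k (u : k.-tuple R[i]) t :
  measurable [set a | abs_pairing u a <= t].
Proof.
rewrite [X in measurable X](_ : _ = abs_pairing u @^-1` `]-oo, t]).
  rewrite -[X in measurable X]setTI; exact: measurable_abs_pairing.
by apply/seteqP; split => x /=; rewrite in_itv.
Qed.

Local Open Scope ereal_scope.

(** The cone over the set lies in a slab of half-width t: scaling a by r <= 1 only decreases the
    pairing with p. The slab bound then applies with a coordinate of size at least 1/(2k). *)
Lemma normalized_surface_measure_abs_pairing k (u : k.-tuple R[i]) (t : R) :
  (2 <= k)%N -> (0 <= t)%R -> cnorm u = 1%R ->
  normalized_surface_measure R k
    (unit_sphere R k `&` [set a | abs_pairing u a <= t]%R) <=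
  (8 * k%:R ^+ 2 * t)%:E.
Proof.
move=> k2 t0; case: k k2 u => // k k2 u u1.
have [p [j [pj pu]]] := cnorm1_coord u1.
rewrite normalized_surface_measureE//.
set C := cone _.
have mC : measurable C.
  apply: measurableI; last exact: measurable_punctured_ball.
  rewrite -[X in measurable X]setTI; apply: measurable_normalize => //.
  apply: measurableI; first exact: measurable_unit_sphere.
  exact: measurable_abs_pairing_le.
have CS : C `<=` slab p 0 1 t.
  move=> x [[_ /= xt] xB]; split; first by move: xB; rewrite punctured_ballE => -[].
  rewrite addr0; case/andP: xB => x0 x1.
  have -> : (\sum_i p i * tnth x i =
      enorm x * \sum_i p i * tnth (normalize x) i)%R.
    rewrite mulr_sumr; apply: eq_bigr => i _; rewrite tnth_map.
    by rewrite mulrCA (mulrC (enorm x)) divfK// gt_eqF.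
  rewrite normrM (ger0_norm (ltW x0)) -[leRHS]mul1r ler_pM ?(ltW x0)//.
  exact: le_trans (pu _) xt.
have pC : (`|p j|%:E * lebesgue_tuple R k.+1 C <= (2 * t)%:E * ball_volume k 1).
  apply: le_trans (lebesgue_tuple_slab p j 0 1 t0).
  rewrite lee_wpmul2l//; apply: le_measure; rewrite ?inE//.
  exact: measurable_slab.
have L0 : 0 <= lebesgue_tuple R k.+1 C by exact: measure_ge0.
(* In dimension K this gives the proportion 4 K (K + 1) t, at most 8 K^2 t since K >= 1. *)
have : (2 * k.+1%:R)^-1%:E * lebesgue_tuple R k.+1 C <=
    (2 * t)%:E * (k.+2%:R%:E * ball_volume k.+1 1).
  apply: le_trans (le_trans pC _); first by rewrite lee_wpmul2r// lee_fin.
  by rewrite lee_wpmul2l ?lee_fin ?mulr_ge0//; exact: le_ball_volumeS.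
move: (lebesgue_tuple R k.+1 C) L0 => L L0.
have := ball_volume_fin_num k.+1 (1 : R); have := ball_volume_gt0 (R := R) k.+1.
case: (ball_volume k.+1 1) => // v; rewrite lte_fin => v0 _ /=.
set K : R := k.+1%:R; have K1 : (1 <= K)%R by rewrite ler1n.
have K0 : (0 < K)%R by exact: lt_le_trans K1.
have -> : k.+2%:R = (K + 1)%R by rewrite natr1.
case: L L0 => [l| |] // L0; last first.
  by rewrite gt0_muley// lte_fin invr_gt0 mulr_gt0.
rewrite -!EFinM !lee_fin ler_pdivrMl ?mulr_gt0// => lv.
rewrite ler_pdivrMl//; apply: (le_trans lv).
have : (0 <= K * (t * v))%R by rewrite !mulr_ge0// ltW.
nra.
Qed.

End surface.

(** * Pointwise bound for a power of the logarithm by a series of indicators *)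

Section log_moment.
Context {R : realType}.

Lemma powR_le_expR (nu y : R) : 0 <= nu -> 0 <= y -> y `^ nu <= expR (nu * y).
Proof.
move=> nu0 y0; rewrite mulrC expRM ge0_ler_powR// ?nnegrE ?expR_ge0//.
by rewrite (le_trans _ (expR_ge1Dx y))// lerDr.
Qed.

(** Apply the exponential bound to w = y ln 2 / nu, so that exp(nu w) = 2^y. *)
Lemma powR_le_expR_ln2 (nu y : R) : 0 < nu -> 0 <= y ->
  y `^ nu <= (nu / ln 2) `^ nu * expR (y * ln 2).
Proof.
move=> nu0 y0; have l2 : 0 < ln 2 :> R by rewrite ln_gt0// ltr1n.
have A0 : 0 < nu / ln 2 by rewrite divr_gt0.
pose w := y * ln 2 / nu.
have w0 : 0 <= w by rewrite divr_ge0 ?mulr_ge0// ltW.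
have -> : y * ln 2 = nu * w by rewrite /w; field; rewrite gt_eqF.
have -> : y = nu / ln 2 * w by rewrite /w; field; rewrite !gt_eqF.
by rewrite powRM ?(ltW A0)// ler_wpM2l ?powR_ge0// powR_le_expR// ltW.
Qed.

Local Open Scope ereal_scope.

(* With Z = |ln q| / L, Z^nu <= (nu / ln 2)^nu 2^Z, and 2^Z is at most 2 if
   Z <= 1 and at most the n-th term of the series if n+1 <= Z <= n+2; the
   series diverges at q = 0. *)
Lemma abs_lne_powR_le (nu L q : R) : (0 < nu)%R -> (0 < L)%R ->
  (0 <= q <= expR L)%R ->
  `| lne q%:E | `^ nu <= ((nu / ln 2 * L) `^ nu)%:E *
    (2%:E + \sum_(n <oo) (2 ^+ n.+2)%:E * (\1_[set x : R | x <= expR (- (L * n.+1%:R))] q)%:E).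
Proof.
move=> nu0 L0 /andP[q0 qL].
set c := ((_ * L) `^ nu)%R; set S := \sum_(n <oo) _.
have l2 : (0 < ln 2 :> R)%R by rewrite ln_gt0// ltr1n.
have c0 : (0 < c)%R by rewrite powR_gt0// mulr_gt0// divr_gt0.
have term_ge0 n : 0 <= (2 ^+ n.+2)%:E *
    (\1_[set x : R | x <= expR (- (L * n.+1%:R))] q)%:E :> \bar R.
  by rewrite mule_ge0// lee_fin// exprn_ge0.
have S0 : 0 <= S by apply: nneseries_ge0 => n _ _; exact: term_ge0.
have termS n : (q <= expR (- (L * n.+1%:R)))%R -> (2 ^+ n.+2)%:E <= S.
  move=> qn; rewrite /S (@nneseriesD1 _ _ n)//.
  rewrite indicE mem_set//= mule1 leeDl//.
  by apply: nneseries_ge0 => m _ _; exact: term_ge0.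
move: q0; rewrite le_eqVlt => /orP[/eqP q0|q0].
  rewrite (_ : S = +oo) ?addey// ?gt0_muley ?lte_fin// ?leey//.
  apply: eq_infty => A; have [A0|A0] := leP A 0%R.
    by rewrite (le_trans _ S0).
  (* For q = 0 every indicator is 1, and the term of index n = [Num.truncn A] exceeds A because A <
     n + 1 < 2^(n+2). *)
  apply: le_trans (termS (Num.truncn A) _); last by rewrite -q0 expR_ge0.
  have /andP[_ An] := truncn_itv (ltW A0).
  rewrite lee_fin (le_trans (ltW An))// -natrX ler_nat.
  by rewrite (leq_trans _ (ltn_expl _ _))// ltnW.
rewrite lne_EFin//=.
pose Z := (`|ln q| / L)%R.
have Z0 : (0 <= Z)%R by rewrite divr_ge0// ltW.
have lnqE : (`|ln q| = L * Z)%R by rewrite /Z mulrC divfK// gt_eqF.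
have -> : (`|ln q| `^ nu = L `^ nu * Z `^ nu)%R.
  by rewrite lnqE powRM// ltW.
apply: (@le_trans _ _ (c * expR (Z * ln 2))%:E).
  have -> : c = ((nu / ln 2) `^ nu * L `^ nu)%R.
    by rewrite /c powRM ?divr_ge0 ?(ltW nu0) ?(ltW l2) ?(ltW L0).
  rewrite lee_fin mulrAC [leRHS]mulrC ler_wpM2l ?powR_ge0//.
  exact: powR_le_expR_ln2.
rewrite EFinM lee_pmul2l//.
have expRn n : (Z <= n%:R)%R -> (expR (Z * ln 2) <= 2 ^+ n)%R.
  move=> Zn; rewrite -[X in (X ^+ n)%R](@lnK _ 2%R) ?posrE// -expRM_natl ler_expR.
  by rewrite ler_wpM2r// ltW.
have [Z1|Z1] := leP Z 1%R.
  by rewrite (@le_trans _ _ 2%:E) ?leeDl// lee_fin -[leRHS](expr1 2%R); exact: expRn.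
have [n nZ Zn] : exists2 n, (n.+1%:R <= Z)%R & (Z <= n.+2%:R)%R.
  have /andP[nZ Zn] := truncn_itv Z0.
  have : (0 < Num.truncn Z)%N by rewrite truncn_gt0 ltW.
  by case: (Num.truncn Z) nZ Zn => // n nZ Zn _; exists n => //; exact: ltW.
apply: (@le_trans _ _ (2 ^+ n.+2)%:E); first by rewrite lee_fin expRn.
rewrite (le_trans (termS n _)) ?leeDr//.
(* When Z > 1, a nonnegative ln q would exceed L, against q <= exp(L); hence q is small. *)
have lnq0 : (ln q < 0)%R.
  rewrite ltNge; apply/negP => lnq0.
  have : (ln q <= L)%R by rewrite -[leRHS]expRK ler_ln ?posrE ?expR_gt0.
  by move: lnqE; rewrite ger0_norm// => ->; rewrite ger_pMr// leNgt Z1.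
rewrite -[leLHS](@lnK _ q) ?posrE// ler_expR.
by rewrite -[ln q]opprK -(ltr0_norm lnq0) lnqE lerN2 ler_pM2l.
Qed.

End log_moment.

(** * Integration of the pointwise bound over the sphere *)

Section log_integral.
Context {R : realType}.
Local Open Scope ereal_scope.

Lemma measurable_lne : measurable_fun setT (fun x : R => lne x%:E).
Proof.
apply: measurable_fun_ifT => //.
- by apply: measurable_fun_ler.
- by apply/measurable_EFinP; exact: measurable_ln.
Qed.

Lemma normalized_surface_measure_unit_sphere k : (2 <= k)%N ->
  normalized_surface_measure R k (unit_sphere R k) = 1.
Proof.
move=> k2; rewrite normalized_surface_measureE// cone_unit_sphere.
rewrite lebesgue_punctured_ball ?(leq_trans _ k2)//.
have := ball_volume_fin_num k (1 : R); have := ball_volume_gt0 (R := R) k.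
case: (ball_volume k 1) => // V V0 _ /=; rewrite lte_fin in V0.
by rewrite -EFinM mulVf// gt_eqF.
Qed.

Lemma integral_abs_log_pairing_le (nu : R) k (u : k.-tuple R[i]) :
  (0 < nu)%R -> (2 <= k)%N -> cnorm u = 1%R ->
  \int[normalized_surface_measure R k]_(a in unit_sphere R k)
    (abs_log_pairing a u `^ nu) <=
  (66 * (nu / ln 2 * (2 * ln k%:R)) `^ nu)%:E.
Proof.
move=> nu0 k2 u1; set sigma := normalized_surface_measure R k.
set L := (2 * ln k%:R)%R; set c := ((_ * L) `^ nu)%R.
have k2' : (2 <= k%:R :> R)%R by rewrite ler_nat.
have k0 : (0 < k%:R :> R)%R by rewrite (lt_le_trans _ k2').
have L0 : (0 < L)%R by rewrite mulr_gt0// ln_gt0// (lt_le_trans _ k2')// ltr1n.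
have expL : expR L = (k%:R ^+ 2)%R by rewrite expRM_natl lnK ?posrE.
pose q (a : k.-tuple R) := abs_pairing u a.
have mq : measurable_fun setT q by exact: measurable_abs_pairing.
have mS := @measurable_unit_sphere R k.
pose E n : set (k.-tuple R) := [set a | q a <= expR (- (L * n.+1%:R))]%R.
have mE n : measurable (E n) by exact: measurable_abs_pairing_le.
pose f n (a : k.-tuple R) : \bar R := (2 ^+ n.+2)%:E * (\1_(E n) a)%:E.
have f0 n a : 0 <= f n a by rewrite mule_ge0// lee_fin exprn_ge0.
have mf n : measurable_fun setT (f n).
  by apply: measurable_funeM; apply/measurable_EFinP; exact: measurable_indic.
have msf : measurable_fun setT (fun a => \sum_(n <oo) f n a).
  exact: ge0_emeasurable_sum.
have sf0 a : 0 <= \sum_(n <oo) f n a by exact: nneseries_ge0.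
apply: (@le_trans _ _ (\int[sigma]_(a in unit_sphere R k)
    (c%:E * (2%:E + \sum_(n <oo) f n a)))).
  apply: ge0_le_integral => //.
  - by move=> a _; exact: poweR_ge0.
  - apply: measurable_funTS; apply: (measurableT_comp (measurable_poweR nu)).
    apply: measurableT_comp => //.
    exact: (measurableT_comp measurable_lne mq).
  - apply: measurable_funTS; apply: measurable_funeM.
    exact: emeasurable_funD.
  move=> a aS; apply: abs_lne_powR_le => //.
  rewrite expL abs_pairing_le// andbT.
  by rewrite -/(abs_pairing u a) abs_pairingE sqrtr_ge0.
rewrite ge0_integralZl_EFin//; last 3 first.
- by move=> a _; rewrite adde_ge0.
- by apply: measurable_funTS; exact: emeasurable_funD.
- exact: powR_ge0.
rewrite [(66 * c)%R]mulrC EFinM lee_wpmul2l ?lee_fin ?powR_ge0//.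
rewrite ge0_integralD//; last by apply: measurable_funTS.
rewrite integral_cst// [X in _ * X]normalized_surface_measure_unit_sphere// mule1.
(* The 2 is the constant term integrated against a probability measure; 64 bounds the series. *)
rewrite (_ : 66%:E = 2%:E + 64%:E); last by rewrite -EFinD -natrD.
rewrite leeD2l// integral_nneseries//; last by move=> n; exact: measurable_funTS.
(* The n-th integral is compared with 64 / 2^(n+1) = 32 * 2^(-n). *)
apply: le_trans (epsilon_trick0 xpredT (ler0n R 64)).
apply: lee_nneseries => [n _ _|n _]; first by apply: integral_ge0.
rewrite ge0_integralZl_EFin//; last first.
  by apply: measurable_funTS; apply/measurable_EFinP; exact: measurable_indic.
rewrite integral_indic// setIC.
have := normalized_surface_measure_abs_pairing k2 (expR_ge0 (- (L * n.+1%:R))) u1.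
move=> /(lee_wpmul2l (_ : 0 <= (2 ^+ n.+2)%:E)) => /(_ _)/le_trans; apply.
  by rewrite lee_fin exprn_ge0.
(* The factor k^2 cancels one of the n+1 powers of k^(-2), leaving 2^(n+2) * 8 k^(-2n) = 32 (2
   k^(-2))^n; finally 2 k^(-2) <= 1/2 as k >= 2. *)
rewrite -EFinM lee_fin -mulNr expRM_natr expRN expL.
rewrite (exprS (_ ^-1)%R) (mulrA (8 * _)%R) mulfK ?expf_neq0 ?gt_eqF//.
have : (0 <= (k%:R : R) ^- 2 <= 4^-1)%R.
  by rewrite invr_ge0 sqr_ge0/= lef_pV2 ?posrE ?exprn_gt0//; nra.
move: ((k%:R : R) ^- 2)%R => x /andP[x0 x4].
have -> : (64 / (2 ^ n.+1)%:R = 32 * 2^-1 ^+ n :> R)%R.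
  by rewrite natrX exprS exprVn; field; rewrite expf_neq0.
have -> : (2 ^+ n.+2 * (8 * x ^+ n) = 32 * (2 * x) ^+ n)%R.
  by rewrite exprMn (exprS 2%R n.+1) (exprS 2%R n); ring.
rewrite ler_pM2l// lerXn2r ?nnegrE ?mulr_ge0//.
lra.
Qed.

End log_integral.

Theorem proposition4p4 (R : realType) :
  (forall k : nat, (2 <= k)%N ->
     surface_measure (unit_sphere R k) = (sphere_area R k)%:E) /\
  (forall nu : R, 1 <= nu ->
     exists M : R, 0 < M /\
       forall (k : nat), (2 <= k)%N ->
       forall u : k.-tuple R[i], cnorm u = 1 ->
         (\int[normalized_surface_measure R k]_(a in unit_sphere R k)
              (abs_log_pairing a u `^ nu)
            <= (M * ln (k%:R) `^ nu)%:E)%E).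
Proof.
split=> [k|nu nu1]; first exact: surface_measure_unit_sphere.
have nu0 : 0 < nu by exact: lt_le_trans nu1.
have l2 : 0 < ln 2 :> R by rewrite ln_gt0// ltr1n.
(* The witness is what remains of the moment bound once (log k)^nu is factored out of the power. *)
exists (66 * (nu / ln 2 * 2) `^ nu); split.
  by rewrite mulr_gt0// powR_gt0// mulr_gt0// divr_gt0.
move=> k k2 u u1; apply: le_trans (integral_abs_log_pairing_le nu0 k2 u1) _.
rewrite lee_fin mulrA powRM ?mulrA//.
- by rewrite mulr_ge0// divr_ge0// ltW.
- by rewrite ln_ge0// ler1n (leq_trans _ k2).
Qed.
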